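(* Let $\mathcal{I}$ be a translation invariant ideal on $\mathbb{N}$. If there exists an $\mathcal{I}$-TAD family of cardinality $\mathfrak{c}$, then there is a translation invariant and rich abstract upper density $\delta$ such that $\mathcal{Z}_\delta=\mathcal{I}$.
   Context: For $A\subseteq\mathbb{N}$ and $k\in\mathbb{Z}$, $A+k$ denotes $\{a+k:a\in A\}\cap\mathbb{N}$. An abstract upper density on $\mathbb{N}$ is a function $\delta:\mathcal{P}(\mathbb{N})\to[0,1]$ such that $\delta(\mathbb{N})=1$; $\delta(F)=0$ for every finite $F\subseteq\mathbb{N}$; $A\subseteq B$ implies $\delta(A)\le\delta(B)$; and $\delta(A\cup B)\le\delta(A)+\delta(B)$. It is translation invariant if $\delta(A+k)=\delta(A)$ for all $A\subseteq\mathbb{N}$, $k\in\mathbb{Z}$, and rich if for every $r\in[0,1]$ there is $A\subseteq\mathbb{N}$ with $\delta(A)=r$. $\mathcal{Z}_\delta=\{A\subseteq\mathbb{N}:\delta(A)=0\}$. An ideal on $\mathbb{N}$ is a family $\mathcal{I}\subseteq\mathcal{P}(\mathbb{N})$ closed under finite unions and subsets, containing all finite subsets of $\mathbb{N}$, with $\mathbb{N}\notin\mathcal{I}$; it is translation invariant if $A+k\in\mathcal{I}$ for all $A\in\mathcal{I}$, $k\in\mathbb{Z}$. $\mathcal{I}^+=\{A\subseteq\mathbb{N}:A\notin\mathcal{I}\}$. A family $\mathcal{A}\subseteq\mathcal{P}(\mathbb{N})$ is an $\mathcal{I}$-TAD family if $\mathcal{A}\subseteq\mathcal{I}^+$ and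 $A\cap(B+k)\in\mathcal{I}$ for all distinct $A,B\in\mathcal{A}$ and all $k\in\mathbb{Z}$. $\mathfrak{c}$ is the cardinality of the continuum. *)

(* Defs.v *)
From mathcomp Require Import all_boot all_order all_algebra.
From mathcomp Require Import boolp classical_sets cardinality reals.
Set Implicit Arguments.
Unset Strict Implicit.
Unset Printing Implicit Defensive.
Import Order.TTheory GRing.Theory Num.Theory.
Local Open Scope classical_set_scope.
Local Open Scope ring_scope.

(* A + k; integers a + k falling outside nat are discarded. *)
Definition translate_set (A : set nat) (k : int) : set nat :=
  [set n : nat | exists2 a, A a & n%:Z = a%:Z + k].

Record abstract_upper_density (R : realType) (delta : set nat -> R) : Prop := {
  aud_range : forall A, 0 <= delta A <= 1;
  aud_setT : delta [set: nat] = 1;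
  aud_finite : forall F, finite_set F -> delta F = 0;
  aud_mono : forall A B, A `<=` B -> delta A <= delta B;
  aud_subadd : forall A B, delta (A `|` B) <= delta A + delta B }.

Definition translation_invariant_density (R : realType)
    (delta : set nat -> R) : Prop :=
  forall (A : set nat) (k : int), delta (translate_set A k) = delta A.

Definition rich_density (R : realType) (delta : set nat -> R) : Prop :=
  forall r : R, 0 <= r <= 1 -> exists A : set nat, delta A = r.

Definition null_sets (R : realType) (delta : set nat -> R) : set (set nat) :=
  [set A | delta A = 0].

Record ideal_on_nat (I : set (set nat)) : Prop := {
  ideal_setU : forall A B, I A -> I B -> I (A `|` B);
  ideal_subset : forall A B, A `<=` B -> I B -> I A;
  ideal_finite : forall F, finite_set F -> I F;
  ideal_proper : ~ I [set: nat] }.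

Definition translation_invariant_ideal (I : set (set nat)) : Prop :=
  forall (A : set nat) (k : int), I A -> I (translate_set A k).

Definition positive_sets (I : set (set nat)) : set (set nat) :=
  [set A | ~ I A].

Definition TAD_family (I F : set (set nat)) : Prop :=
  F `<=` positive_sets I /\
  forall A B : set nat, F A -> F B -> A <> B ->
    forall k : int, I (A `&` translate_set B k).

(* Main.v *)
Require Import Defs.
From mathcomp Require Import all_boot all_order all_algebra.
From mathcomp Require Import boolp classical_sets cardinality reals.
From mathcomp Require Import zify lra.
Import Order.TTheory GRing.Theory Num.Theory.
Local Open Scope classical_set_scope.
Local Open Scope ring_scope.
Local Open Scope card_scope.

(** Enumerate the TAD family as [(A_r)] with [r] real.  Let [J_t] be the
    translation invariant ideal generated by [I] and the [A_r] with
    [0 < r <= t], and let [delta B] be the infimum of [1] and of all [t > 0]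
    with [B] in [J_t].  Every member of [J_t] meets the translates of [A_r],
    [r > t], in sets of [I]; hence [delta (A_r) = r] for [0 < r <= 1] and
    [delta N = 1].  A set of [J_t] is covered modulo [I] by translates of
    finitely many [A_r]; below the least of these indices [r], [J_t'] only
    contains sets almost disjoint from it, so [delta B = 0] forces [B] to lie
    in [I]. *)

Lemma translate_setD (A : set nat) (j k : int) :
  translate_set (translate_set A j) k `<=` translate_set A (j + k).
Proof. by move=> n [m [a Aa mE] nE]; exists a => //; rewrite nE mE addrA. Qed.

Lemma translate_set0 (A : set nat) : translate_set A 0 = A.
Proof.
apply/seteqP; split=> [n [a Aa]|n An]; last by exists n; rewrite ?addr0.
by rewrite addr0 => -[->].
Qed.

Lemma translate_setS (A B : set nat) (k : int) :
  A `<=` B -> translate_set A k `<=` translate_set B k.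
Proof. by move=> AB n [a /AB Ba nE]; exists a. Qed.

Lemma translate_setU (A B : set nat) (k : int) :
  translate_set (A `|` B) k `<=` translate_set A k `|` translate_set B k.
Proof. by move=> n [a [Aa|Ba] nE]; [left|right]; exists a. Qed.

Lemma translate_setI (A B : set nat) (j k : int) :
  translate_set A j `&` translate_set B k `<=`
  translate_set (A `&` translate_set B (k - j)) j.
Proof.
by move=> n [[a Aa nE] [b Bb nE']]; exists a => //; split=> //; exists b => //; lia.
Qed.

(* The initial segment catches the elements that [k] shifts out of [nat]. *)
Lemma translate_setK (A : set nat) (k : int) :
  A `<=` `I_(`|k|%N.+1) `|` translate_set (translate_set A k) (- k).
Proof.
move=> n An; case: (ltnP n `|k|%N.+1) => nk; [by left | right].
exists `|(n%:Z + k)%R|%N; last by lia.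
by exists n => //; lia.
Qed.

(** Closure rules replace explicit finite covers, so facts about [J_t] go by induction on the
    generation. *)
Inductive generated_ideal (R : realType) (I : set (set nat))
    (A : R -> set nat) (t : R) : set nat -> Prop :=
| generated_base B : I B -> generated_ideal R I A t B
| generated_translate r k : 0 < r -> r <= t ->
    generated_ideal R I A t (translate_set (A r) k)
| generated_setU B C : generated_ideal R I A t B -> generated_ideal R I A t C ->
    generated_ideal R I A t (B `|` C)
| generated_subset B C : B `<=` C -> generated_ideal R I A t C ->
    generated_ideal R I A t B.
Arguments generated_ideal {R}.

Definition translate_orthogonal (T : Type) (I : set (set nat))
    (A : T -> set nat) : Prop :=
  forall r s, r <> s -> forall k, I (A r `&` translate_set (A s) k).

Section GeneratedIdeal.
Context {R : realType} {I : set (set nat)} {A : R -> set nat}.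
Hypotheses (idealI : ideal_on_nat I) (invI : translation_invariant_ideal I).
Hypothesis orthA : translate_orthogonal R I A.

Lemma generated_le (t u : R) (B : set nat) :
  t <= u -> generated_ideal I A t B -> generated_ideal I A u B.
Proof.
move=> tu; elim=> {B} [B IB|r k r0 rt|B C _ gB _ gC|B C BC _ gC].
- exact: generated_base.
- by apply: generated_translate => //; apply: le_trans tu.
- exact: generated_setU.
- exact: generated_subset gC.
Qed.

Lemma generated_shift (t : R) (B : set nat) (k : int) :
  generated_ideal I A t B -> generated_ideal I A t (translate_set B k).
Proof.
elim=> {B} [B IB|r j r0 rt|B C _ gB _ gC|B C BC _ gC].
- by apply: generated_base; apply: invI.
- apply: generated_subset (translate_setD _ _ _) _.
  exact: generated_translate.
- apply: generated_subset (translate_setU _ _ _) _; exact: generated_setU.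
- exact: generated_subset (translate_setS _ _ _ BC) gC.
Qed.

Lemma generated_shiftE (t : R) (B : set nat) (k : int) :
  generated_ideal I A t (translate_set B k) <-> generated_ideal I A t B.
Proof.
split=> [gB|]; last exact: generated_shift.
(* Shifting back by [- k] recovers [B] up to a finite set, which lies in [I]. *)
apply: generated_subset (translate_setK B k) _; apply: generated_setU.
  by apply: generated_base; apply: (ideal_finite idealI); exact: finite_II.
exact: generated_shift.
Qed.

Lemma ideal_setIU (B C D : set nat) :
  I (B `&` D) -> I (C `&` D) -> I ((B `|` C) `&` D).
Proof. by rewrite setIUl; apply: ideal_setU. Qed.

(** For a generator [A s], [s <= t < r] gives [s <> r]; the two translates then meet inside one
    translate of a set that orthogonality puts in [I]. *)
Lemma generated_orthogonal (t r : R) (B : set nat) (k : int) :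
  t < r -> generated_ideal I A t B -> I (B `&` translate_set (A r) k).
Proof.
move=> tr; elim=> {B} [B IB|s j s0 st|B C _ gB _ gC|B C BC _ gC].
- by apply: (ideal_subset idealI) IB; exact: subIsetl.
- apply: (ideal_subset idealI) (translate_setI _ _ _ _) _.
  apply: invI; apply: orthA => sr.
  by move: (le_lt_trans st tr); rewrite sr ltxx.
- exact: ideal_setIU.
- by apply: (ideal_subset idealI) gC; exact: setSI.
Qed.

(** The threshold is read off a generation of [B]: the index [r] at a generator, the minimum at a
    union, an arbitrary positive number on [I]. It is positive because all indices used are. *)
Lemma generated_threshold (t : R) (B : set nat) :
  generated_ideal I A t B ->
  exists2 e : R, 0 < e &
    forall u C, u < e -> generated_ideal I A u C -> I (B `&` C).
Proof.
elim=> {B} [B IB|r k r0 rt|B C _ [e e0 He] _ [d d0 Hd]|B C BC _ [e e0 He]].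
- exists 1 => // u C _ _; apply: (ideal_subset idealI) IB; exact: subIsetl.
- exists r => // u C ur gC; rewrite setIC; exact: generated_orthogonal gC.
- exists (Num.min e d) => [|u D]; first by rewrite lt_min e0.
  rewrite lt_min => /andP[ue ud] gD.
  by apply: ideal_setIU; [exact: He gD | exact: Hd gD].
- exists e => // u D ue gD; apply: (ideal_subset idealI) (He _ _ ue gD).
  exact: setSI.
Qed.

Lemma generated_small (B : set nat) :
  (forall e : R, 0 < e -> exists2 t, t < e & generated_ideal I A t B) -> I B.
Proof.
move=> smallB; have [t _ gB] := smallB 1 ltr01.
have [e e0 He] := generated_threshold _ _ gB.
(* The threshold of [B] is applied to [B] itself, generated at a lower level. *)
by have [u ue gu] := smallB e e0; rewrite -(setIid B); apply: He gu.
Qed.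

(** The unconditional level 1 keeps the set nonempty and caps the infimum at 1. *)
Definition generation_levels (B : set nat) : set R :=
  [set t | t = 1 \/ 0 < t /\ generated_ideal I A t B].

Definition level_density (B : set nat) : R := inf (generation_levels B).

Lemma levels_gt0 (B : set nat) (t : R) : generation_levels B t -> 0 < t.
Proof. by case=> [->|[]]. Qed.

Lemma level_density_le (B : set nat) (t : R) :
  generation_levels B t -> level_density B <= t.
Proof.
by move=> Bt; apply: ge_inf => //; exists 0 => u /levels_gt0/ltW.
Qed.

Lemma le_level_density (B : set nat) (x : R) :
  (forall t, generation_levels B t -> x <= t) -> x <= level_density B.
Proof. by move=> Bx; apply: lb_le_inf => //; exists 1; left. Qed.

Lemma level_density_lt (B : set nat) (x : R) :
  level_density B < x -> exists2 t, generation_levels B t & t < x.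
Proof. by move=> Bx; apply: inf_lt Bx; exists 1; left. Qed.

Lemma level_density_range (B : set nat) : 0 <= level_density B <= 1.
Proof.
apply/andP; split; first by apply: le_level_density => t /levels_gt0/ltW.
by apply: level_density_le; left.
Qed.

Lemma level_density_ideal (B : set nat) : level_density B = 0 <-> I B.
Proof.
split=> [B0|IB].
  apply: generated_small => e e0.
  (* A level strictly below 1 is not the conventional one, so it witnesses actual generation. *)
  have [|t Bt] := level_density_lt B (Num.min e 1).
    by rewrite B0 lt_min e0 ltr01.
  rewrite lt_min => /andP[te t1]; exists t => //.
  by case: Bt => [t1E|[]//]; rewrite t1E ltxx in t1.
apply/eqP; rewrite eq_le; have /andP[-> _] := level_density_range B.
rewrite andbT; apply/ler_addgt0Pl => e e0; rewrite addr0.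
by apply: level_density_le; right; split=> //; apply: generated_base.
Qed.

Lemma level_density_mono (B C : set nat) :
  B `<=` C -> level_density B <= level_density C.
Proof.
move=> BC; apply: le_level_density => t [->|[t0 gC]].
  by apply: level_density_le; left.
by apply: level_density_le; right; split=> //; exact: generated_subset gC.
Qed.

Lemma level_density_subadd (B C : set nat) :
  level_density (B `|` C) <= level_density B + level_density C.
Proof.
(* Each infimum is isolated in turn. If a chosen level is 1, the bound 1 on the density suffices;
   otherwise both sets are generated at level [t + u]. *)
rewrite -lerBlDr; apply: le_level_density => t Bt.
rewrite lerBlDr -lerBlDl; apply: le_level_density => u Cu.
rewrite lerBlDl; have t0 := levels_gt0 _ _ Bt; have u0 := levels_gt0 _ _ Cu.
have /andP[_ d1] := level_density_range (B `|` C).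
case: Bt => [tE|[_ gB]]; first lra.
case: Cu => [uE|[_ gC]]; first lra.
apply: level_density_le; right; split; first by rewrite addr_gt0.
by apply: generated_setU; [apply: generated_le gB | apply: generated_le gC]; lra.
Qed.

Lemma level_density_shift : translation_invariant_density level_density.
Proof.
move=> B k; congr inf; apply/seteqP; split=> t [->|[t0 gB]]; try by left.
- by right; split=> //; apply/(generated_shiftE t B k).
- by right; split=> //; apply/(generated_shiftE t B k).
Qed.

Hypothesis posA : forall r, ~ I (A r).

(** At a level below [r], [A r] would be orthogonal to itself and hence in [I]. *)
Lemma level_density_generator (r : R) : 0 < r -> r <= 1 -> level_density (A r) = r.
Proof.
move=> r0 r1; apply/eqP; rewrite eq_le; apply/andP; split.
  apply: level_density_le; right; split=> //.
  by rewrite -[A r]translate_set0; apply: generated_translate.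
apply: le_level_density => t [->//|[t0 gA]]; rewrite leNgt; apply/negP => tr.
apply: (posA r); have := generated_orthogonal _ _ _ 0 tr gA.
by rewrite translate_set0 setIid.
Qed.

Lemma level_density_setT : level_density [set: nat] = 1.
Proof.
apply/eqP; rewrite eq_le; have /andP[_ ->] /= := level_density_range setT.
apply: le_level_density => t [->//|[t0 gT]].
(* Indices range over all reals, so some generator, here [A (t + 1)], lies beyond any level and
   would be in [I]. *)
have tt1 : t < t + 1 by rewrite ltrDl.
have := generated_orthogonal _ _ _ 0 tt1 gT.
by rewrite translate_set0 setTI => /posA.
Qed.

End GeneratedIdeal.

Theorem theorem3p1 (R : realType) (I : set (set nat))
    (idealI : ideal_on_nat I)
    (invI : translation_invariant_ideal I)
    (tadI : exists F : set (set nat), TAD_family I F /\ F #= [set: R]) :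
  exists delta : set nat -> R,
    [/\ abstract_upper_density delta,
        translation_invariant_density delta,
        rich_density delta
      & null_sets delta = I].
Proof.
case: tadI => F [[posF orthF]]; rewrite card_eq_sym => /card_set_bijP[A [AF Ainj _]].
have posA r : ~ I (A r) by apply: posF; apply: AF.
have orthA : translate_orthogonal R I A.
  move=> r s rs; apply: orthF; [exact: AF|exact: AF|].
  by move=> /Ainj; rewrite !in_setT => /(_ isT isT).
have nullE B := level_density_ideal idealI invI orthA B.
exists (@level_density R I A); split.
- split.
  + exact: level_density_range.
  + exact: level_density_setT.
  + by move=> B finB; apply/nullE; apply: ideal_finite.
  + exact: level_density_mono.
  + exact: level_density_subadd.
- exact: level_density_shift.
(* Generators realize only positive values; 0 is the density of the empty set. *)
- move=> r /andP[]; rewrite le_eqVlt => /predU1P[<- _|r0 r1].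
    by exists set0; apply/nullE; apply: ideal_finite.
  by exists (A r); apply: level_density_generator.
- by apply/seteqP; split=> B /nullE.
Qed.
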